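(* Let $\mathsf{L}$ be an orthocomplemented lattice (not necessarily complete) and let $\mathsf{E}_{\mathsf{L}}$ be its event space completion. Then $\mathsf{E}_{\mathsf{L}}$ is distributive if and only if $\mathsf{L}$ is distributive.
   Context: Let $(\mathsf{L},\subseteq,\cup,\cap,{}^c,\mathbf{0},\mathbf{1})$ be an orthocomplemented lattice. A term is a function $i\in I\mapsto a^i\in\mathsf{L}$, written $\bigsqcup_{i\in I}a^i$, with $|I|\leq2^{|\mathsf{L}|}$; $\mathsf{T}(\mathsf{L})$ is the collection of terms. Put $\bigsqcup_{i\in I}a^i\backsim\bigsqcup_{j\in J}b^j$ iff for every $i\in I$ there is $j\in J$ with $a^i\subseteq b^j$ (if $J=\emptyset$: $a^i=\mathbf{0}$), and for every $j\in J$ there is $i\in I$ with $b^j\subseteq a^i$ (if $I=\emptyset$: $b^j=\mathbf{0}$). This is an equivalence relation; $\mathsf{D}(\mathsf{L}):=\mathsf{T}(\mathsf{L})/\backsim$. For families with larger index sets, $[\bigsqcup_{i\in I}a^i]$ denotes the class of the terms equivalent (same condition) to the family. Every class has a representative with $I\neq\emptyset$, and such representatives are always used. Order: $[\bigsqcup_{i\in I}a^i]\leq[\bigsqcup_{j\in J}b^j]$ iff $[\bigsqcup_{i\in I}a^i\sqcup\bigsqcup_{j\in J}b^j]=[\bigsqcup_{j\in J}b^j]$ (here $\sqcup$ is the family on the disjoint union of $I$ and $J$). With it $\mathsf{D}(\mathsf{L})$ is a (completely distributive) complete lattice with suprema $\bigvee$, infima $\bigwedge$, bottom $[\mathbf{0}]$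 and top $[\mathbf{1}]$. One regards $\mathsf{L}\subseteq\mathsf{D}(\mathsf{L})$ via the injection $a\mapsto[a]$; then $[\bigsqcup_{i\in I}a^i]=\bigvee_{i\in I}a^i$. The (well-defined, order-reversing) function $*:\mathsf{D}(\mathsf{L})\to\mathsf{D}(\mathsf{L})$ is $\big(\bigvee_{i\in I}a^i\big)^*=\bigwedge_{i\in I}(a^i)^c$, with infimum taken in $\mathsf{D}(\mathsf{L})$. The event space completion of $\mathsf{L}$ is $\mathsf{E}_{\mathsf{L}}=\{\mathbb{A}\in\mathsf{D}(\mathsf{L}):\mathbb{A}=\mathbb{A}^{**}\}=\{\mathbb{A}^*:\mathbb{A}\in\mathsf{D}(\mathsf{L})\}$ with the inherited order. It contains $\mathsf{L}$ and is an orthocomplemented complete lattice with the same infima, bottom and top as $\mathsf{D}(\mathsf{L})$, supremum $\coprod S=(\bigvee S)^{**}$ for $S\subseteq\mathsf{E}_{\mathsf{L}}$, and orthocomplementation $*$. *)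

(* Defs.v *)
From HB Require Import structures.
From mathcomp Require Export all_boot all_order.
From mathcomp Require Export boolp classical_sets.

Set Implicit Arguments.
Unset Strict Implicit.
Unset Printing Implicit Defensive.

Import Order.TTheory.
Local Open Scope classical_set_scope.
Local Open Scope order_scope.
Local Open Scope quotient_scope.

HB.mixin Record isOrthocomplemented d T of Order.TBLattice d T := {
  ortho : T -> T;
  orthoK : involutive ortho;
  le_ortho : forall x y : T, x <= y -> ortho y <= ortho x;
  meetxO : forall x : T, x `&` ortho x = \bot;
  joinxO : forall x : T, x `|` ortho x = \top
}.

#[short(type="orthoLatticeType")]
HB.structure Definition OrthoLattice d :=
  {T of Order.TBLattice d T & isOrthocomplemented d T}.

Fact free_display : Order.disp_t -> Order.disp_t.
Proof. exact: id. Qed.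
Fact event_display : Order.disp_t -> Order.disp_t.
Proof. exact: id. Qed.

Section Completion.
Context {d : Order.disp_t}.
Variable L : orthoLatticeType d.

Definition fam_dominated (I J : Type) (a : I -> L) (b : J -> L) : Prop :=
  (inhabited J -> forall i, exists j, a i <= b j) /\
  (~ inhabited J -> forall i, a i = \bot).

Definition fam_equiv (I J : Type) (a : I -> L) (b : J -> L) : Prop :=
  fam_dominated a b /\ fam_dominated b a.

(* The index sets of cardinality at most 2 ^ |L| are, up to bijection, the
   subsets of the powerset of L. Terms use these subsets themselves as index
   sets, so that they form a type in the universe of L; see term_reindex. *)
Record term := Term { index : set (set L); fam : index -> L }.

Lemma term_reindex (I : Type) (f : I -> set L) (a : I -> L) : injective f ->
  exists (t : term) (r : I -> index t),
    bijective r /\ forall i, fam (r i) = a i.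
Proof.
move=> finj.
have P (s : range f) : exists i, f i = \val s.
  by case: s => s /= /set_mem[i _ <-]; exists i.
pose g s := projT1 (cid (P s)).
have gE s : f (g s) = \val s by rewrite /g; case: cid.
pose r i : range f := SigSub (mem_set (imageT f i)).
exists (@Term (range f) (fun s => a (g s))), r.
have rK : cancel r g by move=> i; apply: finj; rewrite gE.
split; last by move=> i /=; rewrite rK.
by exists g => // s; apply: val_inj; rewrite /= gE.
Qed.

HB.instance Definition _ := gen_eqMixin term.
HB.instance Definition _ := gen_choiceMixin term.

(* The set of elements of L below the formal supremum of a family. *)
Definition fam_down (I : Type) (a : I -> L) : set L :=
  [set x | x = \bot \/ exists i, x <= a i].

Lemma fam_dominatedP (I J : Type) (a : I -> L) (b : J -> L) :
  fam_dominated a b <-> fam_down a `<=` fam_down b.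
Proof.
split=> [[ne e] x [->|[i xa]]|sub]; first by left.
- have [J0|J0] := pselect (inhabited J).
    by have [j ab] := ne J0 i; right; exists j; apply: le_trans ab.
  by left; apply/eqP; rewrite -lex0 -(e J0 i).
- split=> J0 i.
    have [->|//] : fam_down b (a i) by apply: sub; right; exists i.
    by case: J0 => j; exists j; rewrite le0x.
  have [//|[j _]] : fam_down b (a i) by apply: sub; right; exists i.
  by case: J0.
Qed.

Lemma fam_equivP (I J : Type) (a : I -> L) (b : J -> L) :
  fam_equiv a b <-> fam_down a = fam_down b.
Proof.
rewrite /fam_equiv !fam_dominatedP.
by split=> [[ab ba]|->]; [exact/seteqP|split].
Qed.

Definition term_equiv (s t : term) : bool :=
  `[< fam_equiv (@fam s) (@fam t) >].

Lemma term_equivP s t :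
  reflect (fam_down (@fam s) = fam_down (@fam t)) (term_equiv s t).
Proof. by apply: (iffP (asboolP _)) => /fam_equivP. Qed.

Fact term_equiv_refl : reflexive term_equiv.
Proof. by move=> s; apply/term_equivP. Qed.
Fact term_equiv_sym : symmetric term_equiv.
Proof.
by move=> s t; apply/idP/idP => /term_equivP E; apply/term_equivP; rewrite E.
Qed.
Fact term_equiv_trans : transitive term_equiv.
Proof.
move=> t s u /term_equivP st /term_equivP tu.
by apply/term_equivP; rewrite st.
Qed.

Canonical term_equiv_rel :=
  EquivRel term_equiv term_equiv_refl term_equiv_sym term_equiv_trans.

(* The completely distributive lattice D(L); L embeds in it through emb. *)
Definition free := {eq_quot term_equiv}.
HB.instance Definition _ := Choice.on free.
HB.instance Definition _ := EqQuotient.on free.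

Lemma term_of_fam (I : Type) (a : I -> L) :
  exists t : term, fam_equiv (@fam t) a /\ (inhabited I -> inhabited (index t)).
Proof.
have P (s : range (fun i => [set a i])) : exists x, [set x] = \val s.
  by case: s => s /= /set_mem[i _ <-]; exists (a i).
pose g s := projT1 (cid (P s)).
have gE s : [set g s] = \val s by rewrite /g; case: cid.
pose h i : range (fun i => [set a i]) :=
  SigSub (mem_set (imageT (fun i => [set a i]) i)).
exists (@Term _ g); split; last by move=> [i]; split; exact: h i.
apply/fam_equivP/seteqP; split=> x [->|[i xi]]; try by left.
- right; have /set_mem[j _ je] := valP i; exists j.
  have : [set g i] (a j) by rewrite gE -je.
  by move=> /= ->.
- right; exists (h i) => /=; have : \val (h i) (a i) by [].
  by rewrite -gE => /= <-.
Qed.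

(* The class of the terms equivalent to a family, whose index type may be
   arbitrarily large. *)
Definition cls (I : Type) (a : I -> L) : free :=
  \pi_free (projT1 (cid (term_of_fam a))).

Lemma cls_termE (I : Type) (a : I -> L) (t : term) :
  \pi_free t = cls a <-> fam_equiv (@fam t) a.
Proof.
rewrite /cls; case: cid => s /= [/fam_equivP sa _]; rewrite fam_equivP -sa.
by split=> [/eqquotP/term_equivP|h] //; apply/eqquotP/term_equivP.
Qed.

Lemma cls_eqP (I J : Type) (a : I -> L) (b : J -> L) :
  cls a = cls b <-> fam_equiv a b.
Proof.
have [s [sa _]] := term_of_fam a; rewrite -((cls_termE a s).2 sa) cls_termE.
by move: sa; rewrite !fam_equivP => ->.
Qed.

Lemma nonempty_rep_subproof (A : free) :
  exists t : term, inhabited (index t) /\ \pi_free t = A.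
Proof.
pose a (o : option (index (repr A))) := if o is Some i then fam i else \bot.
have [t [ta /(_ (inhabits None)) t0]] := term_of_fam a.
exists t; split=> //; rewrite -[RHS]reprK; apply/eqquotP/term_equivP.
move/fam_equivP: ta => ->; apply/seteqP; split=> x [->|[i xi]]; try by left.
- by case: i xi => [i|] /= xi; [right; exists i|left; apply/eqP; rewrite -lex0].
- by right; exists (Some i).
Qed.

Definition nonempty_rep (A : free) : term :=
  projT1 (cid (nonempty_rep_subproof A)).

Lemma nonempty_repK A : \pi_free (nonempty_rep A) = A.
Proof. by rewrite /nonempty_rep; case: cid => t []. Qed.

Lemma nonempty_rep_inhabited A : inhabited (index (nonempty_rep A)).
Proof. by rewrite /nonempty_rep; case: cid => t []. Qed.

Definition sqcup (I J : Type) (a : I -> L) (b : J -> L) (k : I + J) : L :=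
  match k with inl i => a i | inr j => b j end.

Definition free_le (A B : free) : bool :=
  cls (sqcup (@fam (nonempty_rep A)) (@fam (nonempty_rep B))) == B.

Definition down (A : free) : set L := fam_down (@fam (nonempty_rep A)).

Lemma down_cls (I : Type) (a : I -> L) : down (cls a) = fam_down a.
Proof. by apply/fam_equivP/cls_termE; exact: nonempty_repK. Qed.

Lemma downK (A : free) : cls (fun x : down A => \val x) = A.
Proof.
rewrite -[RHS](nonempty_repK A); apply/esym/cls_termE/fam_equivP.
apply/seteqP; split=> x => [xA|[->|[[y /= /set_mem yA] xy]]]; last 2 first.
- by left.
- case: yA => [y0|[i yi]]; last by right; exists i; apply: le_trans yi.
  by left; apply/eqP; rewrite -lex0 -y0.
by right; exists (SigSub (mem_set xA)).
Qed.

Lemma down_inj : injective down.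
Proof. by move=> A B AB; rewrite -(downK A) AB downK. Qed.

Lemma free_leP (A B : free) : reflect (down A `<=` down B) (free_le A B).
Proof.
have E : down (cls (sqcup (@fam (nonempty_rep A)) (@fam (nonempty_rep B)))) =
         down A `|` down B.
  rewrite down_cls; apply/seteqP; split=> x.
    by case=> [->|[[i|j] xi]]; [left; left|left; right; exists i
                                |right; right; exists j].
  case=> [] [->|[i xi]]; try by left.
  - by right; exists (inl i).
  - by right; exists (inr i).
apply: (iffP eqP) => [<-|AB]; first by rewrite E; left.
by apply: down_inj; rewrite E; apply/setUidPr.
Qed.

Fact free_le_refl : reflexive free_le.
Proof. by move=> A; apply/free_leP. Qed.
Fact free_le_anti : antisymmetric free_le.
Proof.
by move=> A B /andP[/free_leP AB /free_leP BA]; apply/down_inj/seteqP.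
Qed.
Fact free_le_trans : transitive free_le.
Proof.
move=> B A C /free_leP AB /free_leP BC; apply/free_leP.
exact: subset_trans BC.
Qed.

HB.instance Definition _ := Order.Le_isPOrder.Build (free_display d) free
  free_le_refl free_le_anti free_le_trans.

Lemma freeleP (A B : free) : reflect (down A `<=` down B) (A <= B).
Proof. exact: free_leP. Qed.

Definition emb (x : L) : free := cls (fun _ : unit => x).

Lemma down_emb x : down (emb x) = [set y | y <= x].
Proof.
rewrite down_cls; apply/seteqP; split=> y /=; last by right; exists tt.
by case=> [->|[]//]; exact: le0x.
Qed.

Lemma down_bot A : down A \bot. Proof. by left. Qed.

Fact free_le0 (A : free) : emb \bot <= A.
Proof.
apply/freeleP => x; rewrite down_emb /= lex0 => /eqP ->; exact: down_bot.
Qed.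
Fact free_le1 (A : free) : A <= emb \top.
Proof. by apply/freeleP => x _; rewrite down_emb /= lex1. Qed.

HB.instance Definition _ :=
  Order.hasBottom.Build (free_display d) free free_le0.
HB.instance Definition _ :=
  Order.hasTop.Build (free_display d) free free_le1.

(* The first argument is the value on the empty set. *)
Definition free_sup (S : set free) : free := supremum \bot S.
Definition free_inf (S : set free) : free := infimum \top S.

Lemma free_supP (S : set free) (B : free) :
  (free_sup S <= B) <-> (forall A, S A -> A <= B).
Proof.
rewrite /free_sup /supremum; case: ifPn => [/eqP ->|_].
  by split=> // _; exact: le0x.
have SS : supremums S !=set0.
  exists (cls (fun p : {x : L | exists2 A, S A & down A x} => sval p)).
  split=> [A SA|B' ub]; apply/freeleP => x; rewrite down_cls.
    by move=> xA; right; exists (exist _ x (ex_intro2 _ _ A SA xA)).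
  case=> [->|[[y [A SA yA]] /= xy]]; first exact: down_bot.
  move/freeleP: (ub _ SA); apply.
  case: yA => [y0|[i yi]]; last by right; exists i; apply: le_trans yi.
  by left; apply/eqP; rewrite -lex0 -y0.
have [ub lub] : supremums S (xget \bot (supremums S)).
  by case: SS => s Ss; exact: (xgetPex \bot (ex_intro _ s Ss)).
split=> [h A SA|h]; last exact: lub.
by apply: le_trans h; apply: ub.
Qed.

Lemma free_infP (S : set free) (B : free) :
  (B <= free_inf S) <-> (forall A, S A -> B <= A).
Proof.
rewrite /free_inf /infimum; case: ifPn => [/eqP ->|_].
  by split=> // _; exact: lex1.
have SS : infimums S !=set0.
  exists (free_sup (lbound S)); split=> [A SA|B' lb].
    by apply/free_supP => B' /(_ _ SA).
  by move/free_supP: (lexx (free_sup (lbound S))); apply.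
have [lb glb] : infimums S (xget \top (infimums S)).
  by case: SS => s Ss; exact: (xgetPex \top (ex_intro _ s Ss)).
split=> [h A SA|h]; last exact: glb.
by apply: le_trans h _; apply: lb.
Qed.

Definition star (A : free) : free :=
  free_inf (range (fun i => emb (ortho (@fam (nonempty_rep A) i)))).

Lemma down_star A :
  down (star A) = [set x | forall y, down A y -> x <= ortho y].
Proof.
apply/seteqP; split=> x.
  move=> xA y [->|[i yi]].
    suff -> : ortho \bot = \top :> L by exact: lex1.
    by rewrite -[LHS]join0x joinxO.
  have /free_infP/(_ _ (imageT _ i))/freeleP/(_ _ xA) := lexx (star A).
  by rewrite down_emb /= => xi; exact: (le_trans xi (le_ortho _ _ yi)).
move=> /= xA; suff : emb x <= star A.
  by move/freeleP; apply; rewrite down_emb /=.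
apply/free_infP => _ [i _ <-]; apply/freeleP => y; rewrite !down_emb /=.
by move=> yx; apply: (le_trans yx); apply: xA; right; exists i.
Qed.

Lemma star_cls (I : Type) (a : I -> L) :
  star (cls a) = free_inf (range (fun i => emb (ortho (a i)))).
Proof.
apply/le_anti/andP; split; last first.
  apply/freeleP => x xa; rewrite down_star => y; rewrite down_cls.
  case=> [->|[i yi]].
    suff -> : ortho \bot = \top :> L by exact: lex1.
    by rewrite -[LHS]join0x joinxO.
  have /free_infP/(_ _ (imageT _ i))/freeleP/(_ _ xa) :=
    lexx (free_inf (range (fun i => emb (ortho (a i))))).
  by rewrite down_emb /= => xi; exact: (le_trans xi (le_ortho _ _ yi)).
apply/free_infP => _ [i _ <-]; apply/freeleP => x.
by rewrite down_star down_emb; apply; rewrite down_cls; right; exists i.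
Qed.

Lemma le_star A B : A <= B -> star B <= star A.
Proof.
move=> /freeleP AB; apply/freeleP => x; rewrite !down_star => xB y /AB.
exact: xB.
Qed.

Lemma le_starstar A : A <= star (star A).
Proof.
apply/freeleP => x xA; rewrite down_star => y; rewrite down_star => /(_ _ xA).
by move=> /le_ortho; rewrite orthoK.
Qed.

Lemma starstarstar A : star (star (star A)) = star A.
Proof. by apply/le_anti; rewrite le_starstar le_star// le_starstar. Qed.

(* The event space completion E_L, with the order, infima, and biorthogonally
   closed suprema coming from D(L). *)
Record event :=
  Event { event_val :> free; _ : event_val == star (star event_val) }.

HB.instance Definition _ := [isSub for event_val].
HB.instance Definition _ := [Choice of event by <:].
HB.instance Definition _ :=
  [SubChoice_isSubPOrder of event by <: with event_display d].

Lemma event_leE (A B : event) : (A <= B) = (event_val A <= event_val B).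
Proof. by []. Qed.

Lemma event_starstar (A : event) : star (star A) = A :> free.
Proof. by case: A => A /= /eqP. Qed.

Fact event_meet_subproof (A B : event) :
  free_inf [set event_val A; event_val B] ==
  star (star (free_inf [set event_val A; event_val B])).
Proof.
apply/eqP/le_anti/andP; split; first exact: le_starstar.
apply/free_infP => C SC.
have -> : C = star (star C) by case: SC => ->; rewrite event_starstar.
by do 2!apply: le_star; move: C SC; apply/free_infP.
Qed.

Definition event_meet (A B : event) : event :=
  Event (event_meet_subproof A B).

Fact event_join_subproof (A B : event) :
  star (star (free_sup [set event_val A; event_val B])) ==
  star (star (star (star (free_sup [set event_val A; event_val B])))).
Proof. by rewrite starstarstar. Qed.

Definition event_join (A B : event) : event :=
  Event (event_join_subproof A B).

Fact event_lexI (C A B : event) :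
  (C <= event_meet A B) = (C <= A) && (C <= B).
Proof.
rewrite !event_leE; apply/idP/andP => [/free_infP h|[CA CB]].
  by split; apply: h; [left|right].
by apply/free_infP => _ [->|->].
Qed.

Fact event_leUx (A B C : event) :
  (event_join A B <= C) = (A <= C) && (B <= C).
Proof.
rewrite !event_leE; apply/idP/andP => [h|[AC BC]].
  have /free_supP {}h := le_trans (le_starstar _) h.
  by split; apply: h; [left|right].
rewrite -[leRHS]event_starstar; do 2!apply: le_star.
by apply/free_supP => _ [->|->].
Qed.

HB.instance Definition _ :=
  Order.POrder_isMeetSemilattice.Build (event_display d) event event_lexI.
HB.instance Definition _ :=
  Order.POrder_isJoinSemilattice.Build (event_display d) event event_leUx.

End Completion.

Arguments term {d} L.
Arguments free {d} L.
Arguments event {d} L.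

Definition lattice_distributive d (T : latticeType d) : Prop :=
  @left_distributive T T Order.meet Order.join.

(* Main.v *)
Require Import Defs.

Import Order.TTheory.
Local Open Scope classical_set_scope.
Local Open Scope order_scope.

(** An element of the completion is determined by the lower set [down A] of the
    elements of L below it.  On lower sets, meets are intersections, [star] is
    the polar for the relation x <= y^c, and joins are bipolars of unions.

    If the completion is distributive then so is L, because the embedding of L
    sends each element to its principal lower set and preserves meets and
    joins ([event_emb_meet], [event_emb_join]), hence L is a sublattice.

    If L is distributive then x <= y^c holds as soon as x and y are disjoint
    ([le_ortho_disjoint]).  For z in both A v B and C, the element z belongs to
    (A ^ C) v (B ^ C) when z <= w^c for every w in the polars of A ^ C and
    B ^ C.  For each a in A the element z ^ a lies in A ^ C, so w, z and a have
    meet bottom; thus w ^ z is in the polar of A, and likewise in that of B.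
    As z is in the bipolar of the union, z and w ^ z are orthogonal, which
    forces w ^ z to be bottom and gives z <= w^c. *)

Section Distributivity.
Context {d : Order.disp_t} {L : orthoLatticeType d}.
Implicit Types (x y z w : L) (A B C : event L).

Lemma le_orthoC x y : (x <= ortho y) = (y <= ortho x).
Proof. by apply/idP/idP => /le_ortho; rewrite orthoK. Qed.

Lemma emb_leP x (A : free L) : emb x <= A <-> down A x.
Proof.
split=> [/freeleP|xA]; first by apply; rewrite down_emb /=.
apply/freeleP => y; rewrite down_emb /= => yx.
case: xA => [x0|[i xi]]; last by right; exists i; apply: le_trans xi.
by left; apply/eqP; rewrite -lex0 -x0.
Qed.

Lemma down_le (A : free L) x y : x <= y -> down A y -> down A x.
Proof.
move=> xy /emb_leP yA; apply/emb_leP; apply: le_trans yA.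
by apply/emb_leP; rewrite down_emb.
Qed.

Lemma star_emb x : star (emb x) = emb (ortho x).
Proof.
apply/down_inj/seteqP; split=> y; rewrite down_star !down_emb /=.
  exact.
by move=> yx z zx; apply: le_trans yx (le_ortho _ _ zx).
Qed.

(** Membership in a polar as an upper bound condition: this lets the universal
    property of suprema compute the polar of a supremum. *)
Lemma down_starP (A : free L) w : down (star A) w <-> A <= emb (ortho w).
Proof.
rewrite down_star /=; split=> [h|/freeleP h y /h]; last first.
  by rewrite down_emb /= le_orthoC.
by apply/freeleP => y /h; rewrite down_emb /= le_orthoC.
Qed.

Lemma down_meet A B x : down (A `&` B) x <-> down A x /\ down B x.
Proof.
split=> [/emb_leP/free_infP h|[/emb_leP xA /emb_leP xB]].
  by split; apply/emb_leP; apply: h; [left|right].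
by apply/emb_leP/free_infP => _ [->|->].
Qed.

Lemma down_join A B x : down (A `|` B) x <->
  (forall w, down (star A) w -> down (star B) w -> x <= ortho w).
Proof.
have E w : down (star (free_sup [set event_val A; event_val B])) w <->
           down (star A) w /\ down (star B) w.
  split=> [/down_starP/free_supP h|[]].
    by split; apply/down_starP; apply: h; [left|right].
  move=> /down_starP hA /down_starP hB.
  by apply/down_starP/free_supP => _ [->|->].
have -> : event_val (A `|` B) =
  star (star (free_sup [set event_val A; event_val B])) by [].
rewrite down_star /=; split=> [h w wA wB|h w /E[]]; last exact: h.
by apply/h/E.
Qed.

Lemma event_leP A B : A <= B <-> (forall x, down A x -> down B x).
Proof. by rewrite event_leE; split=> [/freeleP|h]; [|apply/freeleP]. Qed.

Fact event_emb_subproof x : emb x == star (star (emb x)).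
Proof. by rewrite !star_emb orthoK. Qed.

Definition event_emb x : event L := Event (event_emb_subproof x).

Lemma down_event_emb x y : down (event_emb x) y <-> y <= x.
Proof. by rewrite down_emb. Qed.

Lemma event_emb_inj : injective event_emb.
Proof.
move=> x y xy; apply/le_anti/andP; split; apply/down_event_emb.
  by rewrite -xy; apply/down_event_emb.
by rewrite xy; apply/down_event_emb.
Qed.

Lemma event_emb_meet x y : event_emb (x `&` y) = event_emb x `&` event_emb y.
Proof.
apply/le_anti/andP; split; apply/event_leP => z.
  move/down_event_emb; rewrite lexI => /andP[zx zy].
  by apply/down_meet; split; apply/down_event_emb.
move=> /down_meet[/down_event_emb zx /down_event_emb zy].
by apply/down_event_emb; rewrite lexI zx.
Qed.

(** Binary joins survive because every event is an intersection of principal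
    lower sets, so an event containing x and y contains their join. *)
Lemma event_emb_join x y : event_emb (x `|` y) = event_emb x `|` event_emb y.
Proof.
have polarE u w : down (star (event_emb u)) w <-> w <= ortho u.
  by rewrite /= star_emb down_emb.
apply/le_anti/andP; split; apply/event_leP => z.
  move=> /down_event_emb zxy; apply/down_join => w /polarE wx /polarE wy.
  by apply: (le_trans zxy); rewrite leUx le_orthoC wx le_orthoC wy.
move=> /down_join/(_ (ortho (x `|` y))); rewrite orthoK => h.
by apply/down_event_emb/h; apply/polarE/le_ortho; rewrite ?leUl ?leUr.
Qed.

(** Distributivity makes the orthocomplement a pseudocomplement. *)
Lemma le_ortho_disjoint : lattice_distributive L ->
  forall x y, x `&` y = \bot -> x <= ortho y.
Proof.
move=> distL x y xy0.
have -> : x = (y `|` ortho y) `&` x by rewrite joinxO meet1x.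
by rewrite distL (meetC y) xy0 join0x leIl.
Qed.

Lemma lattice_distributive_event :
  lattice_distributive L -> lattice_distributive (event L).
Proof.
move=> distL A B C; apply/le_anti/andP; split; last first.
  (* This inequality holds in every lattice. *)
  by rewrite leUx !lexI !leIr (le_trans (leIl _ _) (leUl _ _))
             (le_trans (leIl _ _) (leUr _ _)).
apply/event_leP => z /down_meet[/down_join zAB zC].
apply/down_join => w wAC wBC.
have polar (D : event L) :
    down (star (D `&` C)) w -> down (star D) (w `&` z).
  rewrite !down_star /= => wDC a aD.
  have /wDC wza : down (D `&` C) (z `&` a).
    apply/down_meet; split; last exact: down_le (leIl _ _) zC.
    exact: down_le (leIr _ _) aD.
  apply: le_ortho_disjoint => //; rewrite -meetA.
  apply/eqP; rewrite -lex0 -(meetxO (z `&` a)) [leRHS]meetC.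
  exact: leI2.
have zwz := zAB _ (polar _ wAC) (polar _ wBC).
apply: le_ortho_disjoint => //; rewrite meetC.
apply/eqP; rewrite -lex0 -(meetxO (w `&` z)) lexI lexx /=.
exact: le_trans (leIr _ _) zwz.
Qed.

Lemma lattice_distributive_of_event :
  lattice_distributive (event L) -> lattice_distributive L.
Proof.
move=> distE x y z; apply: event_emb_inj.
by rewrite event_emb_join !event_emb_meet event_emb_join distE.
Qed.

End Distributivity.

Theorem theorem29 (d : Order.disp_t) (L : orthoLatticeType d) :
  lattice_distributive (event L) <-> lattice_distributive L.
Proof.
split; [exact: lattice_distributive_of_event|exact: lattice_distributive_event].
Qed.
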